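(* Let $A$ be a set of preferences endowed with preference relation $R$, and suppose that its asymmetric part $F=P_R$ is negatively transitive. Then: (i) The relation $E_R$ is symmetric and $\mathcal{E}=E_F$ is an equivalence relation on $A$. (ii) $\mathcal{E}=E\cup E_R$, where $E=I_R$ is the symmetric part of $R$. (iii) The relation $F$ is $\mathcal{E}$-saturated. (iv) The relation $E$ is weakly $\mathcal{E}$-saturated. (v) The relation $R$ is weakly $\mathcal{E}$-saturated. Let $A'=A/\mathcal{E}$ be the factor-set, let $R'$ be the weak factor-relation of $R$ with respect to $\mathcal{E}$, and let $\bar F$ be the factor-relation of $F$ with respect to $\mathcal{E}$. Then: (vi) $R'=D_{A'}\cup\bar F$ and $D_{A'}\cap\bar F=\emptyset$. (vii) $R'$ is a reflexive, transitive, antisymmetric, and complete binary relation on $A'$ with asymmetric part $\bar F$, and the factor-set $A'$ endowed with $R'$ is a linearly ordered set. (viii) The inverse images $A_\iota=p^{-1}(\iota)$, $\iota\in A'$, of the canonical surjective map $p\colon A\to A'$ are $E$-saturated, and any $A_\iota$ furnished with the equivalence relation $E_\iota$ induced by $E$ is a balloon. (ix) The set of preferences $A$ is equal to the coproduct $\coprod_{\iota\in A'}A_\iota$ of the family $(A_\iota)_{\iota\in A'}$ of balloons (as a preordered set, the index set $A'$ being linearly ordered by $R'$).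
   Context: A set of preferences (preordered set) is a non-empty set $A$ with a preference relation (preorder) $R$, i.e. a reflexive and transitive binary relation, not necessarily complete. For a binary relation $R$ on $A$: $R^{-1}$ is the inverse relation and $R^c$ the complement in $A^2$; $I_R=R\cap R^{-1}$ is the symmetric part; $P_R=R\setminus I_R$ is the asymmetric part; $E_R=(R\cup R^{-1})^c$, i.e. $xE_Ry$ means that $x,y$ are not $R$-comparable (neither $xRy$ nor $yRx$). $D_A$ is the diagonal of $A^2$. $R$ is complete if for all $x,y$ one has $xRy$ or $yRx$. $F$ is negatively transitive if $F^c$ is transitive, i.e. $xFz$ implies $xFy$ or $yFz$ for every $y\in A$. Let $\mathcal{E}$ be an equivalence relation on $A$, and write $\bar x$ for the class of $x$. A subset $B\subset A$ is $\mathcal{E}$-saturated if $x\in B$ implies $\bar x\subset B$. A binary relation $R$ is $\mathcal{E}$-saturated if $xRy$, $x'\mathcal{E}x$, $y'\mathcal{E}y$ imply $x'Ry'$. $R$ is weakly $\mathcal{E}$-saturated if $xRy$ and $x'\mathcal{E}x$ imply that there exists $y'$ with $y'\mathcal{E}y$ and $x'Ry'$. If $F$ is $\mathcal{E}$-saturated, its factor-relation is $\bar F=\{(\bar x,\bar y)\mid xFy\}$ on $A/\mathcal{E}$. For any $R$, its weak factor-relation $R'$ on $A/\mathcal{E}$ is defined by: $\bar xR'\bar y$ if for any $x'\in\bar x$ there exists $y'\in\bar y$ such that $x'Ry'$. The canonical surjective map is $x\mapsto\bar x$. A balloon is a set endowed with an equivalence relation, viewed as a (symmetric) preorder. Coproduct: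 for a family $(A_\iota)_{\iota\in I}$ of pairwise disjoint preordered sets with preorders $R_\iota$ and partially ordered index set $I$ (with strict part $<$), the coproduct $\coprod_{\iota\in I}A_\iota$ is the union of the $A_\iota$, with projection $p$ ($p(x)=\iota$ for $x\in A_\iota$), endowed with the preorder: $x$ is related to $y$ if ''$p(x)<p(y)$'' or ''$p(x)=p(y)$ and $xR_{p(x)}y$''. *)

(* Defs.v *)
From Stdlib Require Import Relations RelationClasses Ensembles.

Definition preference_set {A : Type} (R : relation A) : Prop :=
  inhabited A /\ preorder A R.

Definition complete {A : Type} (R : relation A) : Prop :=
  forall x y, R x y \/ R y x.

Definition linear_order {A : Type} (R : relation A) : Prop :=
  order A R /\ complete R.

Definition intersection {A : Type} (R S : relation A) : relation A :=
  fun x y => R x y /\ S x y.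

Definition difference {A : Type} (R S : relation A) : relation A :=
  fun x y => R x y /\ ~ S x y.

Definition symmetric_part {A : Type} (R : relation A) : relation A :=
  intersection R (transp A R).

Definition asymmetric_part {A : Type} (R : relation A) : relation A :=
  difference R (symmetric_part R).

Definition incomparable {A : Type} (R : relation A) : relation A :=
  complement (union A R (transp A R)).

Definition negatively_transitive {A : Type} (F : relation A) : Prop :=
  transitive A (complement F).

Definition eq_class {A : Type} (Eq : relation A) (x : A) : Ensemble A :=
  fun y => Eq y x.

Definition saturated_subset {A : Type} (Eq : relation A) (B : Ensemble A) :
    Prop :=
  forall x, B x -> Included A (eq_class Eq x) B.

Definition saturated_relation {A : Type} (Eq R : relation A) : Prop :=
  forall x y x' y', R x y -> Eq x' x -> Eq y' y -> R x' y'.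

Definition weakly_saturated {A : Type} (Eq R : relation A) : Prop :=
  forall x y x', R x y -> Eq x' x -> exists y', Eq y' y /\ R x' y'.

(** The type of classes makes sense for every relation [Eq]; it is the quotient
    set (with [canon x = canon y <-> Eq x y], by extensionality and proof
    irrelevance) only when [Eq] is an equivalence. *)
Definition quotient {A : Type} (Eq : relation A) : Type :=
  {C : Ensemble A | exists x, C = eq_class Eq x}.

Definition canon {A : Type} (Eq : relation A) (x : A) : quotient Eq :=
  exist _ (eq_class Eq x) (ex_intro _ x eq_refl).

(** Meaningful when [F] is [Eq]-saturated. *)
Definition factor_relation {A : Type} (Eq F : relation A) :
    relation (quotient Eq) :=
  fun X Y => exists x y, X = canon Eq x /\ Y = canon Eq y /\ F x y.

Definition weak_factor_relation {A : Type} (Eq R : relation A) :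
    relation (quotient Eq) :=
  fun X Y => forall x', proj1_sig X x' ->
    exists y', proj1_sig Y y' /\ R x' y'.

Definition fiber {A I : Type} (p : A -> I) (i : I) : Ensemble A :=
  fun x => p x = i.

Definition induced {A : Type} (R : relation A) (B : Ensemble A) :
    relation (sig B) :=
  fun x y => R (proj1_sig x) (proj1_sig y).

Definition balloon {T : Type} (E : relation T) : Prop := equivalence T E.

(** The coproduct is internal to an ambient type [U]: the pieces are pairwise
    disjoint subsets [B i] of [U], and the coproduct is the subset
    [coproduct_set B] with the relation [coproduct_rel le B Rs].  Disjointness
    makes the index of a point of the union, its projection, unique. *)
Record coproduct_family {U I : Type} (le : relation I) (B : I -> Ensemble U)
    (Rs : forall i, relation (sig (B i))) : Prop := {
  coproduct_index : order I le;
  coproduct_disjoint : forall i j, i <> j -> Disjoint U (B i) (B j);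
  coproduct_piece : forall i, preference_set (Rs i)
}.

Definition coproduct_set {U I : Type} (B : I -> Ensemble U) : Ensemble U :=
  fun x => exists i, B i x.

Definition coproduct_rel {U I : Type} (le : relation I) (B : I -> Ensemble U)
    (Rs : forall i, relation (sig (B i))) : relation U :=
  fun x y =>
    (exists i j, B i x /\ B j y /\ asymmetric_part le i j) \/
    (exists i (hx : B i x) (hy : B i y), Rs i (exist _ x hx) (exist _ y hy)).

(* Main.v *)
(** If [F] is asymmetric and negatively transitive, then [~ F y x] is a total
    preorder whose symmetric part is [incomparable F]; passing to the quotient
    turns it into a linear order with strict part induced by [F].  For
    [F = asymmetric_part R] this linear order is the weak factor relation of
    [R], because [R x y] splits into [F x y] and [symmetric_part R x y], and the
    latter keeps [x] and [y] in the same class. *)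

Require Import Defs.
From Stdlib Require Import Relations RelationClasses Ensembles.
From Stdlib Require Import Classical FunctionalExtensionality PropExtensionality.

Lemma relation_ext {A : Type} (R S : relation A) :
  (forall x y, R x y <-> S x y) -> R = S.
Proof.
  intros H.
  apply functional_extensionality; intros x.
  apply functional_extensionality; intros y.
  apply propositional_extensionality, H.
Qed.

Lemma canon_surjective {A : Type} (Eq : relation A) (X : quotient Eq) :
  exists x, X = canon Eq x.
Proof.
  destruct X as [C [x ->]]; exists x; reflexivity.
Qed.

Lemma canon_eq_iff {A : Type} (Eq : relation A) (hEq : equivalence A Eq)
    (x y : A) : canon Eq x = canon Eq y <-> Eq x y.
Proof.
  destruct hEq as [hrefl htrans hsym]; split; intros H.
  (* Membership of [x] in its own class is transported along the equality of classes. *)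
  - change (eq_class Eq y x).
    rewrite <- (f_equal (@proj1_sig _ _) H : eq_class Eq x = eq_class Eq y).
    apply hrefl.
  - assert (HC : eq_class Eq x = eq_class Eq y).
    { apply functional_extensionality; intros z.
      apply propositional_extensionality; unfold eq_class.
      split; intros Hz; eauto. }
    apply eq_sig with HC; apply proof_irrelevance.
Qed.

Lemma factor_relation_canon {A : Type} (Eq F : relation A)
    (hEq : equivalence A Eq) (hF : saturated_relation Eq F) (x y : A) :
  factor_relation Eq F (canon Eq x) (canon Eq y) <-> F x y.
Proof.
  split.
  - intros (x' & y' & Hx & Hy & H).
    apply (canon_eq_iff Eq hEq) in Hx, Hy.
    exact (hF _ _ _ _ H Hx Hy).
  - intros H; exists x, y; auto.
Qed.

(** Incomparability is the intersection of the complement of [F] with its transpose; both are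
    transitive, so the chain is followed once in each direction. Irreflexivity of [F] supplies
    reflexivity. *)
Lemma negatively_transitive_incomparable_equivalence {A : Type}
    (F : relation A) (hirr : forall x, ~ F x x)
    (hF : negatively_transitive F) : equivalence A (incomparable F).
Proof.
  split.
  - intros x [H | H]; exact (hirr x H).
  - intros x y z Hxy Hyz [H | H]; revert H.
    + apply (hF x y z); intros H; [apply Hxy | apply Hyz]; left; exact H.
    + apply (hF z y x); intros H; [apply Hyz | apply Hxy]; right; exact H.
  - intros x y H [H' | H']; apply H; [right | left]; exact H'.
Qed.

(** By contraposition: if [F x' y'] failed, then [F] would fail along each link of the chain [x],
    [x'], [y'], [y], hence between its ends. *)
Lemma negatively_transitive_saturated {A : Type} (F : relation A)
    (hF : negatively_transitive F) : saturated_relation (incomparable F) F.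
Proof.
  intros x y x' y' H Hx Hy; apply NNPP; intros H'; revert H.
  apply (hF x x' y).
  - intros H; apply Hx; right; exact H.
  - apply (hF x' y' y); [exact H' |].
    intros H; apply Hy; left; exact H.
Qed.

Lemma asymmetric_part_iff {A : Type} (R : relation A) (x y : A) :
  asymmetric_part R x y <-> R x y /\ ~ R y x.
Proof.
  unfold asymmetric_part, difference, symmetric_part, intersection, transp.
  tauto.
Qed.

(** Strict preference fails both ways exactly when [R x y] and [R y x] have the same truth value:
    both true is indifference, both false is incomparability. The case split is classical. *)
Lemma incomparable_asymmetric_part_iff {A : Type} (R : relation A) (x y : A) :
  incomparable (asymmetric_part R) x y <->
  symmetric_part R x y \/ incomparable R x y.
Proof.
  unfold incomparable, complement, union, transp.
  rewrite !asymmetric_part_iff.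
  unfold symmetric_part, intersection, transp.
  tauto.
Qed.

Lemma incomparable_asymmetric_part_equivalence {A : Type} (R : relation A)
    (hF : negatively_transitive (asymmetric_part R)) :
  equivalence A (incomparable (asymmetric_part R)).
Proof.
  apply negatively_transitive_incomparable_equivalence; trivial.
  intros x; rewrite asymmetric_part_iff; tauto.
Qed.

Lemma symmetric_part_equivalence {A : Type} (R : relation A)
    (hR : preorder A R) : equivalence A (symmetric_part R).
Proof.
  destruct hR as [hrefl htrans]; split.
  - intros x; split; apply hrefl.
  - intros x y z [H1 H2] [H3 H4]; split; [exact (htrans _ _ _ H1 H3) |].
    exact (htrans _ _ _ H4 H2).
  - intros x y [H1 H2]; split; assumption.
Qed.

Lemma symmetric_part_weakly_saturated {A : Type} (R : relation A)
    (hR : preorder A R) (hF : negatively_transitive (asymmetric_part R)) :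
  weakly_saturated (incomparable (asymmetric_part R)) (symmetric_part R).
Proof.
  pose proof (incomparable_asymmetric_part_equivalence R hF) as hEq.
  (* The witness is [x'] itself: it is indifferent to itself, and indifference of [x] and [y] puts
     it in the class of [y]. *)
  intros x y x' H Hx; exists x'; split.
  - apply (equiv_trans _ _ hEq _ x); trivial.
    apply incomparable_asymmetric_part_iff; left; exact H.
  - split; apply (preord_refl _ _ hR).
Qed.

Lemma preorder_weakly_saturated {A : Type} (R : relation A)
    (hR : preorder A R) (hF : negatively_transitive (asymmetric_part R)) :
  weakly_saturated (incomparable (asymmetric_part R)) R.
Proof.
  intros x y x' H Hx; destruct (classic (R y x)) as [Hyx | Hyx].
  - destruct (symmetric_part_weakly_saturated R hR hF x y x' (conj H Hyx) Hx)
      as (y' & Hy & Hx' & _).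
    exists y'; auto.
  (* In the strict case [y] itself serves, since saturation of [F] moves [x] to [x']. *)
  - exists y; split.
    + unfold incomparable, complement, union, transp.
      rewrite asymmetric_part_iff; tauto.
    + assert (HF : asymmetric_part R x' y).
      { apply (negatively_transitive_saturated _ hF x y); trivial.
        - apply asymmetric_part_iff; auto.
        - unfold incomparable, complement, union, transp.
          rewrite asymmetric_part_iff; tauto. }
      apply HF.
Qed.

(** This removes the quantifiers over classes: order properties of the weak factor relation become
    properties of [F] on representatives. *)
Lemma weak_factor_relation_canon {A : Type} (R : relation A)
    (hR : preorder A R) (hF : negatively_transitive (asymmetric_part R))
    (x y : A) :
  let Eq := incomparable (asymmetric_part R) in
  weak_factor_relation Eq R (canon Eq x) (canon Eq y) <->
  ~ asymmetric_part R y x.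
Proof.
  intros Eq.
  assert (hEq : equivalence A Eq)
    by exact (incomparable_asymmetric_part_equivalence R hF).
  split.
  - intros H Hyx.
    (* The definition is tested at [x]; saturation would turn [F y x] into [F y' x], which excludes
       [R x y']. *)
    destruct (H x (equiv_refl _ _ hEq x)) as (y' & Hy & Hxy).
    assert (HF : asymmetric_part R y' x).
    { apply (negatively_transitive_saturated _ hF y x); trivial.
      apply (equiv_refl _ _ hEq). }
    apply asymmetric_part_iff in HF; tauto.
  - intros H x' Hx; change (Eq x' x) in Hx.
    destruct (classic (asymmetric_part R x y)) as [HF | HF].
    + exact (preorder_weakly_saturated R hR hF x y x' (proj1 HF) Hx).
    (* With [F] failing both ways, [x] and [y] share a class, so [x'] is its own partner. *)
    + exists x'; split; [| apply (preord_refl _ _ hR)].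
      apply (equiv_trans _ _ hEq _ x); trivial.
      intros [H' | H']; tauto.
Qed.

Theorem theorem2p1p1 (A : Type) (R : relation A) (hR : preference_set R)
    (hF : negatively_transitive (asymmetric_part R)) :
  let F := asymmetric_part R in
  let E := symmetric_part R in
  let Eq := incomparable F in
  let A' := quotient Eq in
  let R' : relation A' := weak_factor_relation Eq R in
  let Fbar : relation A' := factor_relation Eq F in
  let p : A -> A' := canon Eq in
  let B : A' -> Ensemble A := fiber p in
  let Es := fun i : A' => induced E (B i) in
  (* (i) *)
  (symmetric A (incomparable R) /\ equivalence A Eq) /\
  (* (ii) *)
  Eq = union A E (incomparable R) /\
  (* (iii) *)
  saturated_relation Eq F /\
  (* (iv) *)
  weakly_saturated Eq E /\
  (* (v) *)
  weakly_saturated Eq R /\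
  (* (vi) *)
  (R' = union A' (@eq A') Fbar /\
   intersection (@eq A') Fbar = (fun _ _ => False)) /\
  (* (vii) *)
  ((reflexive A' R' /\ transitive A' R' /\ antisymmetric A' R' /\
    complete R' /\ asymmetric_part R' = Fbar) /\
   linear_order R') /\
  (* (viii) *)
  (forall i : A', saturated_subset E (B i) /\ balloon (Es i)) /\
  (* (ix) *)
  (coproduct_family R' B Es /\
   coproduct_set B = Full_set A /\
   coproduct_rel R' B Es = R).
Proof.
  intros F E Eq A' R' Fbar p B Es.
  destruct hR as [[a] hpre].
  assert (Fasym : forall x y, F x y -> ~ F y x).
  { intros x y; unfold F; rewrite !asymmetric_part_iff; tauto. }
  assert (hEq : equivalence A Eq)
    by exact (incomparable_asymmetric_part_equivalence R hF).
  assert (hE : equivalence A E) by exact (symmetric_part_equivalence R hpre).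
  assert (hsat : saturated_relation Eq F)
    by exact (negatively_transitive_saturated F hF).
  assert (EqE : forall x y, Eq x y <-> ~ F x y /\ ~ F y x).
  { intros x y; unfold Eq, incomparable, complement, union, transp; tauto. }
  assert (E_Eq : forall x y, E x y -> Eq x y).
  { intros x y H; apply incomparable_asymmetric_part_iff; left; exact H. }
  assert (pE : forall x y, p x = p y <-> Eq x y) by exact (canon_eq_iff Eq hEq).
  assert (FbarE : forall x y, Fbar (p x) (p y) <-> F x y)
    by exact (factor_relation_canon Eq F hEq hsat).
  assert (R'E : forall x y, R' (p x) (p y) <-> ~ F y x)
    by exact (weak_factor_relation_canon R hpre hF).
  assert (psurj : forall X, exists x, X = p x) by exact (canon_surjective Eq).
  assert (R'refl : reflexive A' R').
  { intros X; destruct (psurj X) as [x ->]; apply R'E.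
    intros H; exact (Fasym x x H H). }
  assert (R'trans : transitive A' R').
  { intros X Y Z; destruct (psurj X) as [x ->], (psurj Y) as [y ->],
      (psurj Z) as [z ->].
    (* Transitivity of [R'] is negative transitivity of [F] read from [z] back to [x]. *)
    rewrite !R'E; intros Hxy Hyz; exact (hF z y x Hyz Hxy). }
  assert (R'antisym : antisymmetric A' R').
  { intros X Y; destruct (psurj X) as [x ->], (psurj Y) as [y ->].
    rewrite !R'E, pE, EqE; tauto. }
  assert (R'complete : complete R').
  { intros X Y; destruct (psurj X) as [x ->], (psurj Y) as [y ->].
    rewrite !R'E; specialize (Fasym x y); tauto. }
  assert (R'asym : asymmetric_part R' = Fbar).
  { apply relation_ext; intros X Y.
    destruct (psurj X) as [x ->], (psurj Y) as [y ->].
    (* The strict part of [R'] yields [F x y] only doubly negated, so classical reasoning is used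
       here. *)
    rewrite asymmetric_part_iff, !R'E, FbarE; specialize (Fasym x y); tauto. }
  assert (R'order : order A' R') by (split; assumption).
  assert (hballoon : forall i, balloon (Es i)).
  { intros i; destruct hE as [hrefl htrans hsym]; split.
    - intros x; apply hrefl.
    - intros x y z; apply htrans.
    - intros x y; apply hsym. }
  split; [split; [| exact hEq] |].
  { intros x y H [H' | H']; apply H; [right | left]; exact H'. }
  split.
  { apply relation_ext, incomparable_asymmetric_part_iff. }
  split; [exact hsat |].
  split; [exact (symmetric_part_weakly_saturated R hpre hF) |].
  split; [exact (preorder_weakly_saturated R hpre hF) |].
  split; [split |].
  { apply relation_ext; intros X Y.
    destruct (psurj X) as [x ->], (psurj Y) as [y ->].
    unfold union; rewrite R'E, pE, FbarE, EqE; specialize (Fasym x y); tauto. }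
  { apply relation_ext; intros X Y.
    destruct (psurj X) as [x ->], (psurj Y) as [y ->].
    unfold intersection; rewrite pE, FbarE, EqE; tauto. }
  split; [repeat split; assumption |].
  split; [intros i; split; [| apply hballoon] |].
  { intros x Hx y Hy; rewrite <- Hx; apply pE, E_Eq, Hy. }
  split; [split | split].
  - exact R'order.
  - intros i j Hij; constructor; intros x Hx; destruct Hx as [x Hi Hj].
    apply Hij; rewrite <- Hi; exact Hj.
  - intros i; split.
    + destruct (psurj i) as [x Hx]; constructor; exists x; symmetry; exact Hx.
    + destruct (hballoon i); split; assumption.
  - apply functional_extensionality; intros x.
    apply propositional_extensionality; split; intros _; [constructor |].
    exists (p x); reflexivity.
  - apply relation_ext; intros x y; split.
    (* Across fibers the coproduct relation is [F], because the strict part of [R'] is [Fbar];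
       inside a fiber it is [E]. Both lie in [R]. *)
    + intros [(i & j & <- & <- & H) | (i & hx & hy & H)].
      * rewrite R'asym in H; apply FbarE in H; apply H.
      * apply H.
    + intros H; destruct (classic (R y x)) as [Hyx | Hyx].
      (* Indifferent points lie in one class, so [y] belongs to the fiber over [p x]. *)
      * assert (hy : B (p x) y)
          by exact (proj2 (pE y x) (E_Eq y x (conj Hyx H))).
        right; exists (p x), eq_refl, hy; split; assumption.
      * left; exists (p x), (p y); split; [reflexivity | split; [reflexivity |]].
        rewrite R'asym; apply FbarE, asymmetric_part_iff; auto.
Qed.
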